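(* Let $\mathfrak g_1,\mathfrak g_2$ be two $n$-triadons on the same $n$-dimensional vector space $V$, let $C_i$ be the center of $\mathfrak g_i$ and $l_i=[\mathfrak g_i,\mathfrak g_i]$ its derived subalgebra ($i=1,2$), and put $C_{12}=C_1\cap C_2$. If $\dim C_{12}=n-4$, then $\mathfrak g_1$ and $\mathfrak g_2$ are compatible if and only if $l_i\subset C_{12}$ for $i=1,2$.
   Context: The ground field $\mathbf k$ has characteristic zero. An $n$-triadon is a Lie algebra structure on an $n$-dimensional vector space isomorphic to the direct sum of the $3$-dimensional Heisenberg algebra ($[\varepsilon_1,\varepsilon_2]=\varepsilon_3$, $\varepsilon_3$ central) and the $(n-3)$-dimensional abelian Lie algebra; thus $\dim C_i=n-2$, $\dim l_i=1$, $l_i\subset C_i$. Two Lie algebra structures on $V$ are compatible if the sum of their brackets is a Lie bracket. *)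

(* Defs.v *)
From HB Require Import structures.
From mathcomp Require Import all_boot all_order all_algebra.
From mathcomp Require Import ring.

Set Implicit Arguments.
Unset Strict Implicit.
Unset Printing Implicit Defensive.

Import GRing.Theory.
Local Open Scope ring_scope.

Section LieBracket.

Variables (k : fieldType).

Definition is_lie_bracket (V : lmodType k) (b : V -> V -> V) : Prop :=
  [/\ bilinear_for *:%R *:%R b,
      forall x, b x x = 0
    & forall x y z, b x (b y z) + b y (b z x) + b z (b x y) = 0].

Record lie_structure (V : lmodType k) := LieStructure {
  lie_bracket :> V -> V -> V;
  lie_bracketP : is_lie_bracket lie_bracket
}.

Definition lie_isomorphic (U V : lmodType k)
    (g : lie_structure U) (h : lie_structure V) : Prop :=
  exists2 f : {linear U -> V},
    bijective f & forall x y, f (g x y) = h (f x) (f y).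

Definition compatible (V : lmodType k) (g1 g2 : lie_structure V) : Prop :=
  is_lie_bracket (fun x y => g1 x y + g2 x y).

Lemma abelian_subproof (V : lmodType k) :
  is_lie_bracket (fun _ _ : V => 0).
Proof.
split=> [|//|x y z]; last by rewrite !addr0.
by split=> u a x y /=; rewrite scaler0 addr0.
Qed.

Definition abelian_lie (V : lmodType k) : lie_structure V :=
  LieStructure (@abelian_subproof V).

Definition dsum_bracket (U V : lmodType k)
    (g : lie_structure U) (h : lie_structure V) (x y : U * V) : U * V :=
  (g x.1 y.1, h x.2 y.2).

Lemma dsum_subproof (U V : lmodType k)
    (g : lie_structure U) (h : lie_structure V) :
  is_lie_bracket (dsum_bracket g h).
Proof.
have [[gl gr] ga gj] := lie_bracketP g.
have [[hl hr] ha hj] := lie_bracketP h.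
split=> [|x|x y z].
- by split=> u a x y; apply: injective_projections => /=;
    [exact: gl|exact: hl|exact: gr|exact: hr].
- by rewrite /dsum_bracket ga ha.
- by apply: injective_projections => /=; [exact: gj|exact: hj].
Qed.

Definition dsum_lie (U V : lmodType k)
    (g : lie_structure U) (h : lie_structure V) : lie_structure (U * V)%type :=
  LieStructure (dsum_subproof g h).

(* The basis e_1, e_2, e_3 consists of the unit row vectors of index 0, 1, 2. *)
Definition heisenberg_bracket (x y : 'rV[k]_3) : 'rV[k]_3 :=
  (x 0 0 * y 0 1 - x 0 1 * y 0 0) *: delta_mx 0 2.

Lemma heisenberg_subproof : is_lie_bracket heisenberg_bracket.
Proof.
split=> [|x|x y z].
- split=> u a x y; rewrite /heisenberg_bracket /= scalerA -scalerDl !mxE;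
    by congr (_ *: _); ring.
- by rewrite /heisenberg_bracket [x 0 0 * _]mulrC subrr scale0r.
- have h (u v w : 'rV[k]_3) : heisenberg_bracket u (heisenberg_bracket v w) = 0.
    by rewrite /heisenberg_bracket !mxE /= !mulr0 subrr scale0r.
  by rewrite !h !addr0.
Qed.

Definition heisenberg_lie : lie_structure 'rV[k]_3 :=
  LieStructure heisenberg_subproof.

(* For n < 3 no structure qualifies: the dimensions of the two sides differ. *)
Definition triadon (n : nat) (V : vectType k) (g : lie_structure V) : Prop :=
  \dim {:V} = n /\
  lie_isomorphic g (dsum_lie heisenberg_lie (abelian_lie 'rV[k]_(n - 3))).

(* [linfun] agrees with its argument because the bracket is bilinear; see
   [lie_centerP]. *)
Definition lie_center (V : vectType k) (g : lie_structure V) : {vspace V} :=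
  lker (linfun (fun x : V => linfun (g x))).

Definition lie_derived (V : vectType k) (g : lie_structure V) : {vspace V} :=
  <<[seq g x y | x <- vbasis {:V}, y <- vbasis {:V}]>>%VS.

Section Characterizations.

Variables (V : vectType k) (g : lie_structure V).

Lemma lie_linfunE x y : linfun (g x) y = g x y.
Proof.
have [[_ gr] _ _] := lie_bracketP g.
pose m := GRing.isLinear.Build k V V *:%R (g x) (gr x).
pose f : {linear V -> V} := HB.pack (g x) m.
exact: (lfunE f).
Qed.

Lemma lie_centerP x : reflect (forall y, g x y = 0) (x \in lie_center g).
Proof.
have [[gl _] _ _] := lie_bracketP g.
have lin : linear (fun x : V => linfun (g x)).
  move=> a u v; apply/lfunP => y; rewrite add_lfunE scale_lfunE !lie_linfunE.
  exact: gl.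
pose m := GRing.isLinear.Build k V _ *:%R _ lin.
pose f : {linear V -> 'Hom(V, V)} := HB.pack (fun x : V => linfun (g x)) m.
rewrite memv_ker (lfunE f) /=.
apply: (iffP eqP) => [/lfunP h y|h]; first by rewrite -lie_linfunE h lfunE.
by apply/lfunP => y; rewrite lie_linfunE h lfunE.
Qed.

Lemma lie_derivedP (W : {vspace V}) :
  reflect (forall x y, g x y \in W) (lie_derived g <= W)%VS.
Proof.
have [[gl gr] _ _] := lie_bracketP g.
have gl0 y : g 0 y = 0.
  by have /= := gl y (-1) 0 0; rewrite scaler0 addr0 scaleN1r addNr.
apply: (iffP span_subvP) => [h x y|h _ /allpairsP[[x y] [_ _ ->]]]; last exact: h.
have hb z i : i \in vbasis {:V} -> g z i \in W.
  move=> iB; rewrite (coord_vbasis (memvf z)).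
  elim/big_ind: _ => [|u v uW vW|j _]; first by rewrite gl0 mem0v.
    by rewrite -[u]scale1r gl memvD ?memvZ.
  rewrite -[_ *: _]addr0 gl gl0 addr0 memvZ //.
  by apply/h/allpairs_f => //; apply/mem_nth; rewrite size_tuple.
rewrite -lie_linfunE (coord_vbasis (memvf y)) linear_sum memv_suml // => j _.
rewrite linearZ memvZ //= lie_linfunE hb //.
by apply/mem_nth; rewrite size_tuple.
Qed.

End Characterizations.

End LieBracket.

(* Main.v *)
From HB Require Import structures.
Require Import Defs.
From mathcomp Require Import all_boot all_order all_algebra.

Set Implicit Arguments.
Unset Strict Implicit.

Import GRing.Theory.
Local Open Scope ring_scope.

(** Write C_i for the center of g_i. The sum of two Lie brackets is bilinear and
    alternating, so compatibility amounts to the mixed Jacobi identity, the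
    vanishing of the cyclic sum of
      [x, [y, z]_2]_1 + [x, [y, z]_1]_2    ([lie_compatibleP]).

    If both derived algebras lie in both centers, every mixed term is zero
    ([compatible_derived_central]).

    Conversely, a triadon depends on its arguments only through two linear
    coordinates, so dim C_i >= n - 2 ([triadon_dim_center]), and
    dim (C_1 :&: C_2) = n - 4 forces C_1 + C_2 = V. For any compatible pair with
    C_1 + C_2 = V, only the C_2-components of y and z contribute to [y, z]_1, and
    only the C_1-component of x contributes to [x, _]_2. For x in C_1 and y, z in
    C_2, five of the six terms of the mixed Jacobi identity vanish, leaving
    [x, [y, z]_1]_2 = 0. Thus l_1 is contained in C_2
    ([compatible_derived_center]), and l_1 is contained in C_1 because a triadon
    is nilpotent of class 2. *)

Section LieArithmetic.

Variables (k : fieldType) (V : lmodType k) (g : lie_structure V).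

Lemma lieDl x y z : g (x + y) z = g x z + g y z.
Proof.
have [[gl _] _ _] := lie_bracketP g.
by have /= := gl z 1 x y; rewrite !scale1r.
Qed.

Lemma lieDr x y z : g z (x + y) = g z x + g z y.
Proof.
have [[_ gr] _ _] := lie_bracketP g.
by have /= := gr z 1 x y; rewrite !scale1r.
Qed.

Lemma lie0r x : g x 0 = 0.
Proof. by apply: (addrI (g x 0)); rewrite -lieDr !addr0. Qed.

Lemma lie_anticomm x y : g x y = - g y x.
Proof.
have [_ gxx _] := lie_bracketP g.
have /eqP := gxx (x + y).
by rewrite lieDl !lieDr !gxx add0r addr0 addr_eq0 => /eqP.
Qed.

End LieArithmetic.

Section Compatibility.

Variables (k : fieldType) (V : lmodType k) (g1 g2 : lie_structure V).

Let mixed x y z := g1 x (g2 y z) + g2 x (g1 y z).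

(** The Jacobi sum of g1 + g2 is the sum of the Jacobi sums of g1 and g2, both
    zero, and of the mixed one. *)
Lemma lie_compatibleP :
  compatible g1 g2 <->
  forall x y z, mixed x y z + mixed y z x + mixed z x y = 0.
Proof.
have [[g1l g1r] g1xx g1J] := lie_bracketP g1.
have [[g2l g2r] g2xx g2J] := lie_bracketP g2.
pose s x y := g1 x y + g2 x y.
have sumE x y z : s x (s y z) = g1 x (g1 y z) + g2 x (g2 y z) + mixed x y z.
  by rewrite /s !lieDr [g2 x (g1 _ _) + _]addrC addrACA.
have sum3D (a b c a' b' c' : V) :
    (a + a') + (b + b') + (c + c') = (a + b + c) + (a' + b' + c').
  by rewrite [RHS]addrACA; congr (_ + _); apply: addrACA.
have jacE x y z : s x (s y z) + s y (s z x) + s z (s x y) =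
    mixed x y z + mixed y z x + mixed z x y.
  by rewrite !sumE sum3D [X in X + _]sum3D g1J g2J !add0r.
split=> [[_ _ sJ] x y z|mixedJ]; first by rewrite -jacE; apply: sJ.
split=> [|x|x y z].
- by split=> u a x y /=; rewrite ?g1l ?g2l ?g1r ?g2r /= scalerDr addrACA.
- by rewrite g1xx g2xx addr0.
- by rewrite -[LHS]/(s x (s y z) + s y (s z x) + s z (s x y)) jacE.
Qed.

End Compatibility.

Lemma compatible_sym (k : fieldType) (V : lmodType k) (g1 g2 : lie_structure V) :
  compatible g1 g2 -> compatible g2 g1.
Proof.
move=> /lie_compatibleP mixedJ; apply/lie_compatibleP => x y z.
rewrite -[RHS](mixedJ x y z).
by congr (_ + _ + _); apply: addrC.
Qed.

Section Centers.

Variables (k : fieldType) (V : vectType k).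
Implicit Types g : lie_structure V.

Lemma lie_center_l g x y : x \in lie_center g -> g x y = 0.
Proof. by move/lie_centerP. Qed.

Lemma lie_center_r g x y : y \in lie_center g -> g x y = 0.
Proof. by move=> yC; rewrite lie_anticomm lie_center_l // oppr0. Qed.

Lemma compatible_derived_central g1 g2 :
    (lie_derived g1 <= lie_center g2)%VS -> (lie_derived g2 <= lie_center g1)%VS ->
  compatible g1 g2.
Proof.
move=> /lie_derivedP l1C2 /lie_derivedP l2C1; apply/lie_compatibleP => x y z.
have g12_0 u v w : g1 u (g2 v w) = 0 by apply: lie_center_r.
have g21_0 u v w : g2 u (g1 v w) = 0 by apply: lie_center_r.
by rewrite !g12_0 !g21_0 !addr0.
Qed.

(** Since C_1 and C_2 span V, [x, [y, z]_1]_2 need only be tested on x in C_1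
    and y, z in C_2, where it is the sole surviving term of the mixed Jacobi
    identity. *)
Lemma compatible_derived_center g1 g2 :
    (lie_center g1 + lie_center g2)%VS = fullv -> compatible g1 g2 ->
  (lie_derived g1 <= lie_center g2)%VS.
Proof.
move=> fullC /lie_compatibleP mixedJ.
have split_V u : exists2 u1, u1 \in lie_center g1 &
    exists2 u2, u2 \in lie_center g2 & u = u1 + u2.
  by apply/memv_addP; rewrite fullC memvf.
apply/lie_derivedP => y z; apply/lie_centerP => x; rewrite lie_anticomm.
have [x1 x1C [x2 x2C ->]] := split_V x.
have [y1 y1C [y2 y2C ->]] := split_V y.
have [z1 z1C [z2 z2C ->]] := split_V z.
rewrite !lieDl (lie_center_l _ x2C) addr0 (lie_center_l _ y1C) add0r.
rewrite lieDr (lie_center_r _ z1C) add0r.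
have := mixedJ x1 y2 z2.
rewrite (lie_center_l _ x1C) !(lie_center_l _ y2C) !(lie_center_l _ z2C).
by rewrite (lie_center_r _ y2C) !lie0r !addr0 add0r => ->; rewrite oppr0.
Qed.

End Centers.

Section Triadon.

Variables (k : fieldType) (n : nat) (V : vectType k) (g : lie_structure V).
Hypothesis g_triadon : triadon n g.

Lemma triadon_derived_center : (lie_derived g <= lie_center g)%VS.
Proof.
have [_ [f /bij_inj f_inj fM]] := g_triadon.
apply/lie_derivedP => x y; apply/lie_centerP => z.
apply: f_inj; rewrite !fM linear0; apply: injective_projections => //=.
by rewrite /heisenberg_bracket !mxE /= !mulr0 !mul0r subrr scale0r.
Qed.

(** The Heisenberg bracket involves only the first two coordinates of its
    arguments, so their common kernel, of codimension at most 2, is central. *)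
Lemma triadon_dim_center : (n <= \dim (lie_center g) + 2)%N.
Proof.
have [dimV [f /bij_inj f_inj fM]] := g_triadon.
pose c (x : V) : 'rV[k]_2 := \row_j (f x).1 0 (widen_ord (leqnSn 2) j).
have c_lin : linear c by move=> a x y; apply/rowP => j; rewrite !mxE linearP !mxE.
pose m := GRing.isLinear.Build k V _ *:%R c c_lin.
pose cl : {linear V -> 'rV[k]_2} := HB.pack c m.
have kerC : (lker (linfun cl) <= lie_center g)%VS.
  apply/subvP => x; rewrite memv_ker lfunE => /eqP /rowP cx0.
  apply/lie_centerP => y; apply: f_inj; rewrite fM linear0.
  apply: injective_projections => //=; rewrite /heisenberg_bracket.
  have -> : (f x).1 0 0 = 0.
    by have := cx0 0; rewrite !mxE => <-; congr (_ _ _); apply: val_inj.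
  have -> : (f x).1 0 1 = 0.
    by have := cx0 1; rewrite !mxE => <-; congr (_ _ _); apply: val_inj.
  by rewrite !mul0r subrr scale0r.
rewrite -dimV -(limg_ker_dim (linfun cl) fullv) capfv leq_add ?dimvS //.
by apply: leq_trans (dimvS (subvf _)) _; rewrite dimvf dim_matrix.
Qed.

End Triadon.

Lemma triadon_addv_center (k : fieldType) (n : nat) (V : vectType k)
    (g1 g2 : lie_structure V) :
    triadon n g1 -> triadon n g2 ->
    (\dim (lie_center g1 :&: lie_center g2) + 4 <= n)%N ->
  (lie_center g1 + lie_center g2)%VS = fullv.
Proof.
move=> g1T g2T dimC12; have [dimV _] := g1T.
apply/eqP; rewrite eqEdim subvf dimV.
rewrite -(leq_add2r (\dim (lie_center g1 :&: lie_center g2) + 4)).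
rewrite [leqRHS]addnA dimv_sum_cap -[4%N]/(2 + 2)%N addnACA.
apply: leq_trans (leq_add (triadon_dim_center g1T) (triadon_dim_center g2T)).
by rewrite leq_add2l.
Qed.

Theorem lemma6p1 (k : fieldType) (char_k : [pchar k] =i pred0)
    (n : nat) (V : vectType k) (g1 g2 : lie_structure V)
    (g1_triadon : triadon n g1) (g2_triadon : triadon n g2)
    (dimC12 : (\dim (lie_center g1 :&: lie_center g2) + 4)%N = n) :
  compatible g1 g2 <->
  (lie_derived g1 <= lie_center g1 :&: lie_center g2)%VS /\
  (lie_derived g2 <= lie_center g1 :&: lie_center g2)%VS.
Proof.
have C12V : (lie_center g1 + lie_center g2)%VS = fullv.
  by apply: (triadon_addv_center (n := n)); rewrite ?dimC12.
rewrite !subv_cap; split=> [g12|[/andP[_ l1C2] /andP[l2C1 _]]].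
  rewrite (triadon_derived_center g1_triadon).
  rewrite (triadon_derived_center g2_triadon) andbT /=; split.
    exact: compatible_derived_center g12.
  by apply: compatible_derived_center (compatible_sym g12); rewrite addvC.
exact: compatible_derived_central.
Qed.
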